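(* Let $\tilde H$ be a Hermitian operator on a finite-dimensional Hilbert space, let $|\tilde\psi\rangle$ be a nondegenerate eigenstate of $\tilde H$ with eigenvalue $E$, and let $\{\omega_j\}$ be the energy differences between $E$ and the other eigenvalues $E_j$ of $\tilde H$ (corresponding to the other eigenstates $|\tilde\psi_j\rangle$). Let $T$ be a real random variable with characteristic function $\Phi(\omega)=\mathbb E[e^{i\omega T}]$, and let $\mathcal R^T$ be the quantum operation $\mathcal R^T(\rho)=\mathbb E\big[e^{-i\tilde H T}\rho\, e^{i\tilde H T}\big]$. Then there exists a quantum operation $\mathcal E$ such that for all states $\rho$, $$\|(M^{\mathcal E}-\mathcal R^T)(\rho)\|_{\rm tr}\ \le\ \epsilon=\sup_{\omega_j}|\Phi(\omega_j)|,$$ where $M^{\mathcal E}(\rho)=P\rho P+\mathcal E\big((\mathbb 1-P)\rho(\mathbb 1-P)\big)$ with $P=|\tilde\psi\rangle\langle\tilde\psi|$.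
   Context: $\|A\|_{\rm tr}=\mathrm{tr}|A|$ denotes the trace norm. A quantum operation is a completely positive trace-preserving map. Note $|\Phi(-\omega)|=|\Phi(\omega)|$, so the sign convention for the energy differences is immaterial. *)

(* Defs.v *)
(* MathComp + MathComp-Analysis, complex numbers R[i] from mathcomp-real-closed. *)
From HB Require Import structures.
From mathcomp Require Import all_boot all_order all_algebra.
From mathcomp Require Import complex.
From mathcomp Require Import all_classical all_reals all_analysis.

Set Implicit Arguments.
Unset Strict Implicit.
Unset Printing Implicit Defensive.

Import Order.TTheory GRing.Theory Num.Theory.
Import numFieldTopology.Exports numFieldNormedType.Exports.
Local Open Scope ring_scope.
Local Open Scope classical_set_scope.

Section QDefs.
Variable R : realType.
Local Notation C := (R[i]).

(* embedding of reals and imaginary unit *)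
Definition RtoC (x : R) : C := Complex x 0.
Definition iC : C := Complex 0 1.

(* modulus of a complex number *)
Definition cmod (z : C) : R := Num.sqrt (complex.Re z ^+ 2 + complex.Im z ^+ 2).

(* conjugate transpose A^dagger *)
Definition adjm (m k : nat) (A : 'M[C]_(m, k)) : 'M[C]_(k, m) :=
  (map_mx (fun z : C => z^*) A)^T.

Definition hermitian_mx (n : nat) (A : 'M[C]_n) : Prop := A = adjm A.

(* positive semidefinite matrix *)
Definition psdmx (n : nat) (A : 'M[C]_n) : Prop :=
  A = adjm A /\ forall v : 'cV[C]_n, 0 <= (adjm v *m A *m v) 0 0.

(* density matrix (quantum state) *)
Definition is_state (n : nat) (rho : 'M[C]_n) : Prop := psdmx rho /\ \tr rho = 1.

(* the (unique) positive semidefinite square root of a matrix *)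
Definition psd_sqrt (n : nat) (M : 'M[C]_n) : 'M[C]_n :=
  xget 0 [set B : 'M[C]_n | psdmx B /\ B *m B = M].

(* trace norm ||A||_tr = tr |A|, |A| = sqrt(A^dagger A) *)
Definition trnorm (n : nat) (A : 'M[C]_n) : R := complex.Re (\tr (psd_sqrt (adjm A *m A))).

(* quantum operation = completely positive trace-preserving linear map *)
Definition linear_map (n : nat) (F : 'M[C]_n -> 'M[C]_n) : Prop :=
  forall (a : C) (A B : 'M[C]_n), F (a *: A + B) = a *: F A + F B.

Definition trace_preserving (n : nat) (F : 'M[C]_n -> 'M[C]_n) : Prop :=
  forall A : 'M[C]_n, \tr (F A) = \tr A.

(* complete positivity: id_m (x) F maps PSD block matrices in M_m(M_n) to PSD ones *)
Definition completely_positive (n : nat) (F : 'M[C]_n -> 'M[C]_n) : Prop :=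
  forall (m : nat) (B : 'I_m -> 'I_m -> 'M[C]_n),
    psdmx (\mxblock_(i < m, j < m) B i j) ->
    psdmx (\mxblock_(i < m, j < m) F (B i j)).

Definition quantum_operation (n : nat) (F : 'M[C]_n -> 'M[C]_n) : Prop :=
  [/\ linear_map F, trace_preserving F & completely_positive F].

(* matrix exponential, as the (entrywise) limit of the partial sums of the series *)
Definition expm (n : nat) (A : 'M[C]_n) : 'M[C]_n :=
  \matrix_(a, b)
    Complex (limn (fun N => complex.Re ((\sum_(k < N) (k`!%:R)^-1 *: A ^+ k) a b)))
            (limn (fun N => complex.Im ((\sum_(k < N) (k`!%:R)^-1 *: A ^+ k) a b))).

(* eigenvalues of a Hermitian matrix (real) *)
Definition is_eigenvalue (n : nat) (H : 'M[C]_n) (l : R) : Prop :=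
  exists2 v : 'cV[C]_n, v != 0 & H *m v = RtoC l *: v.

Section Prob.
Variables (d : measure_display) (T : measurableType d) (P : probability T R).

(* expectation of a complex-valued random quantity *)
Definition cexpect (f : T -> C) : C :=
  Complex (\int[P]_w complex.Re (f w)) (\int[P]_w complex.Im (f w)).

(* entrywise expectation of a matrix-valued random quantity *)
Definition mexpect (n : nat) (F : T -> 'M[C]_n) : 'M[C]_n :=
  \matrix_(a, b) cexpect (fun w => F w a b).

(* characteristic function Phi(omega) = E[e^{i omega T}] *)
Definition charfun (X : {RV P >-> R}) (om : R) : C :=
  cexpect (fun w => Complex (cos (om * X w)) (sin (om * X w))).

(* R^T(rho) = E[ e^{-i H T} rho e^{i H T} ] *)
Definition RT (X : {RV P >-> R}) (n : nat) (H : 'M[C]_n) (rho : 'M[C]_n) : 'M[C]_n :=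
  mexpect (fun w => expm (- (iC * RtoC (X w)) *: H) *m rho *m expm ((iC * RtoC (X w)) *: H)).

End Prob.

(* projector onto psi and the map M^E *)
Definition projv (n : nat) (psi : 'cV[C]_n) : 'M[C]_n := psi *m adjm psi.

Definition ME (n : nat) (psi : 'cV[C]_n) (F : 'M[C]_n -> 'M[C]_n) (rho : 'M[C]_n)
  : 'M[C]_n :=
  projv psi *m rho *m projv psi + F ((1 - projv psi) *m rho *m (1 - projv psi)).

End QDefs.

(* Main.v *)
(* Take E := R^T itself.  In an eigenbasis of H with psi as its j0-th vector, R^T
   multiplies the entry (j, k) by the value of Phi at e_k - e_j, so it fixes
   P rho P and commutes with compression by P and 1 - P.  Hence M^E - R^T only
   removes the coherences between psi and its complement, and
   (M^E - R^T)(rho) = u p^dagger + p u^dagger with p spanning P, u orthogonal to p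
   and u_j = - Phi(E - e_j) rho_(j, j0).  Its trace norm is at most 2 |u|.
   Positivity gives |rho_(j, j0)|^2 <= rho_jj a with a = rho_(j0, j0), so
   |u|^2 <= eps^2 a (1 - a) <= (eps / 2)^2. *)

Require Import Defs.
From HB Require Import structures.
From mathcomp Require Import all_boot all_order all_algebra.
From mathcomp Require Import complex.
From mathcomp Require Import all_classical all_reals all_analysis.
From mathcomp Require Import measurable_realfun.
From mathcomp Require Import ring lra.
Import Order.TTheory GRing.Theory Num.Theory.
Import numFieldTopology.Exports numFieldNormedType.Exports.
Local Open Scope ring_scope.
Local Open Scope classical_set_scope.

Set Implicit Arguments.
Unset Strict Implicit.
Unset Printing Implicit Defensive.

(** * Trace norms and positive matrices *)

Lemma adjmE (R : realType) m n (A : 'M[R[i]]_(m, n)) i j :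
  adjm A i j = (A j i)^*.
Proof. by rewrite !mxE. Qed.

Lemma adjmK (R : realType) m n (A : 'M[R[i]]_(m, n)) : adjm (adjm A) = A.
Proof. by apply/matrixP => i j; rewrite !adjmE conjCK. Qed.

Lemma adjmD (R : realType) m n (A B : 'M[R[i]]_(m, n)) :
  adjm (A + B) = adjm A + adjm B.
Proof. by rewrite /adjm map_mxD linearD. Qed.

Lemma adjmB (R : realType) m n (A B : 'M[R[i]]_(m, n)) :
  adjm (A - B) = adjm A - adjm B.
Proof. by rewrite /adjm map_mxB linearB. Qed.

Lemma adjmM (R : realType) m n p (A : 'M[R[i]]_(m, n)) (B : 'M[R[i]]_(n, p)) :
  adjm (A *m B) = adjm B *m adjm A.
Proof. by rewrite /adjm map_mxM trmx_mul. Qed.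

Lemma adjmZ (R : realType) m n (c : R[i]) (A : 'M[R[i]]_(m, n)) :
  adjm (c *: A) = c^* *: adjm A.
Proof. by rewrite /adjm map_mxZ linearZ. Qed.

Lemma conjC_RtoC (R : realType) (x : R) : (RtoC x)^* = RtoC x.
Proof. by apply: CrealP; rewrite complex_real. Qed.

Lemma RtoC_ge0 (R : realType) (x : R) : (0 <= RtoC x) = (0 <= x).
Proof. by rewrite lecE /= eqxx. Qed.

Lemma RtoC_Re (R : realType) (z : R[i]) : 0 <= z -> RtoC (complex.Re z) = z.
Proof. by rewrite lecE /= => /andP[/eqP]; case: z => a b /= ->. Qed.

Lemma RtoCM (R : realType) (x y : R) : RtoC (x * y) = RtoC x * RtoC y.
Proof. by apply/eqP; rewrite eq_complex /= !mulr0 !mul0r subr0 addr0 !eqxx. Qed.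

Lemma RtoCD (R : realType) (x y : R) : RtoC (x + y) = RtoC x + RtoC y.
Proof. by apply/eqP; rewrite eq_complex /= addr0 !eqxx. Qed.

Lemma RtoCN (R : realType) (x : R) : RtoC (- x) = - RtoC x.
Proof. by apply/eqP; rewrite eq_complex /= oppr0 !eqxx. Qed.

Lemma mulC_conj_cmod (R : realType) (z : R[i]) : z * z^* = RtoC (cmod z ^+ 2).
Proof.
rewrite -normCK normc_def -rmorphXn; congr (RtoC (_ ^+ 2)).
Qed.

Lemma Re_RtoCM (R : realType) (x : R) (z : R[i]) :
  complex.Re (RtoC x * z) = x * complex.Re z.
Proof. by case: z => a b /=; rewrite mul0r subr0. Qed.

(** The diagonal entries of [adjm A *m A] are the squared norms of the columns of [A], so each is a
    vanishing sum of nonnegative terms. *)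
Lemma mul_adjm_eq0 (R : realType) m n (A : 'M[R[i]]_(m, n)) :
  adjm A *m A = 0 -> A = 0.
Proof.
move=> A0; apply/matrixP => i j; rewrite mxE.
have /matrixP/(_ j j) := A0; rewrite !mxE => /psumr_eq0P s0.
have /eqP : adjm A j i * A i j = 0.
  by apply: s0 => // k _; rewrite adjmE mulrC mul_conjC_ge0.
by rewrite adjmE mulrC mul_conjC_eq0 => /eqP.
Qed.

(* With [B ^+ 2 = s ^+ 2 Q], [B] is supported on [Q], and expanding
   [0 <= tr ((B - s Q) ^+ 2)] gives [2 s tr B <= 2 s ^+ 2 tr Q]. *)
Lemma mxtrace_sqrt_proj_le (R : realType) n (B Q : 'M[R[i]]_n) (s : R) :
  B = adjm B -> Q = adjm Q -> Q *m Q = Q -> 0 <= s ->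
  B *m B = RtoC (s ^+ 2) *: Q ->
  complex.Re (\tr B) <= s * complex.Re (\tr Q).
Proof.
move=> hB hQ QQ s0 BB.
(* The Gram matrix of [B *m Q - B] is [Q B^2 Q - Q B^2 - B^2 Q + B^2], and with [B^2 = s^2 Q] these
   terms cancel. *)
have BQ : B *m Q = B.
  apply/eqP; rewrite -subr_eq0; apply/eqP; apply: mul_adjm_eq0.
  rewrite adjmB adjmM -hB -hQ mulmxBl !mulmxBr.
  rewrite !mulmxA -![Q *m B *m B]mulmxA BB.
  rewrite -!scalemxAl -!scalemxAr -scalemxAl !QQ.
  by rewrite subrr.
(* The trace inequality carries a factor [s] that is cancelled at the end, so [s = 0] is settled
   apart: there [B^2 = 0], hence [B = 0]. *)
have [s_eq0|s_neq0] := eqVneq s 0.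
  have -> : B = 0 by apply: mul_adjm_eq0; rewrite -hB BB s_eq0 expr0n /= scale0r.
  by rewrite linear0 /= s_eq0 mul0r.
have s_gt0 : 0 < s by rewrite lt_def s_neq0.
have QB : Q *m B = B by rewrite [in LHS]hB [in LHS]hQ -adjmM BQ -hB.
set D := B - RtoC s *: Q.
have hD : D = adjm D by rewrite /D adjmB adjmZ conjC_RtoC -hB -hQ.
have DD : D *m D = 2 *: (RtoC (s ^+ 2) *: Q - RtoC s *: B).
  rewrite /D mulmxBl !mulmxBr BB -!scalemxAl -!scalemxAr BQ QB QQ scalerA -RtoCM -expr2.
  by rewrite opprB -mulr2n scaler_nat.
have : 0 <= \tr (D *m D).
  rewrite {1}hD /mxtrace sumr_ge0 // => i _; rewrite mxE sumr_ge0 // => j _.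
  by rewrite adjmE mulrC mul_conjC_ge0.
rewrite DD mxtraceZ raddfB /= !mxtraceZ pmulr_rge0 ?ltr0n //.
rewrite subr_ge0 lecE => /andP[_]; rewrite !Re_RtoCM.
by rewrite expr2 -mulrA ler_pM2l.
Qed.

(* The junk value [0] only makes the trace norm smaller, so neither existence
   nor uniqueness of the positive square root is needed. *)
Lemma psd_sqrt_spec (R : realType) n (M : 'M[R[i]]_n) :
  (psdmx (psd_sqrt M) /\ psd_sqrt M *m psd_sqrt M = M) \/ psd_sqrt M = 0.
Proof.
have [ex|nex] := pselect (exists B, psdmx B /\ B *m B = M).
  by left; exact: (xgetPex 0 ex).
by right; apply: xgetPN => B PB; apply: nex; exists B.
Qed.

(** By orthogonality the cross terms of [adjm M *m M] vanish, leaving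
    [|u|^2 p p^dagger + u u^dagger = |u|^2 Q], where [Q] projects onto the span of [p] and [u]. For
    [u] nonzero, [Q] has trace 2, whence the factor 2. *)
Lemma trnorm_rank2_le (R : realType) n (u p : 'cV[R[i]]_n) :
  adjm p *m p = 1 -> adjm p *m u = 0 ->
  trnorm (u *m adjm p + p *m adjm u)
    <= 2 * Num.sqrt (complex.Re ((adjm u *m u) 0 0)).
Proof.
move=> pp pu; rewrite /trnorm.
set M := u *m _ + _.
set s2 := complex.Re ((adjm u *m u) 0 0).
have [[[hB _] BB]|->] := psd_sqrt_spec (adjm M *m M); last first.
  by rewrite linear0 /= mulr_ge0 // sqrtr_ge0.
move: (psd_sqrt _) hB BB => B hB BB.
have up : adjm u *m p = 0 by rewrite -[p]adjmK -adjmM pu /adjm map_mx0 trmx0.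
have uu0 : 0 <= (adjm u *m u) 0 0.
  rewrite mxE sumr_ge0 // => j _; rewrite adjmE mulrC; exact: mul_conjC_ge0.
have s20 : 0 <= s2 by have := uu0; rewrite lecE => /andP[].
have uuE : adjm u *m u = (RtoC s2)%:M by rewrite [LHS]mx11_scalar RtoC_Re.
have MM : adjm M *m M = RtoC s2 *: (p *m adjm p) + u *m adjm u.
  rewrite /M adjmD !adjmM !adjmK mulmxDl !mulmxDr !mulmxA.
  rewrite -![_ *m adjm u *m u]mulmxA -![_ *m adjm p *m u]mulmxA.
  rewrite -![_ *m adjm u *m p]mulmxA -![_ *m adjm p *m p]mulmxA.
  rewrite pu up pp uuE !mulmx0 !mul0mx mulmx1 addr0 add0r.
  by rewrite mul_mx_scalar -scalemxAl.
rewrite MM in BB; clear MM M.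
have [s2_eq0|s2_neq0] := eqVneq s2 0.
  have u0 : u = 0.
    by apply: mul_adjm_eq0; rewrite uuE s2_eq0; apply/matrixP => i j; rewrite !mxE mul0rn.
  have -> : B = 0.
    by apply: mul_adjm_eq0; rewrite -hB BB s2_eq0 scale0r u0 mul0mx addr0.
  by rewrite linear0 /= s2_eq0 sqrtr0 mulr0.
have RV : RtoC s2 * RtoC s2^-1 = 1 by rewrite -RtoCM divff.
pose Q := p *m adjm p + RtoC s2^-1 *: (u *m adjm u).
have trQ : complex.Re (\tr Q) = 2.
  rewrite /Q linearD linearZ /= mxtrace_mulC pp [\tr (u *m _)]mxtrace_mulC uuE.
  by rewrite mxtrace1 mxtrace_scalar mulr1n [_ * _]mulrC RV /=.
rewrite mulrC -trQ; apply: mxtrace_sqrt_proj_le => //.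
- by rewrite /Q adjmD adjmZ !adjmM !adjmK conjC_RtoC.
- rewrite /Q mulmxDl !mulmxDr -!scalemxAl -!scalemxAr !mulmxA.
  rewrite -![_ *m adjm u *m u]mulmxA -![_ *m adjm p *m u]mulmxA.
  rewrite -![_ *m adjm u *m p]mulmxA -![_ *m adjm p *m p]mulmxA.
  rewrite pu up pp uuE !mulmx0 !mul0mx mulmx1 !scaler0 addr0 add0r.
  by rewrite mul_mx_scalar -scalemxAl !scalerA [RtoC s2^-1 * RtoC _]mulrC RV mulr1.
- by rewrite sqr_sqrtr // BB /Q scalerDr scalerA RV scale1r.
Qed.

Lemma psdmx_conj (R : realType) m n (V : 'M[R[i]]_(m, n)) (A : 'M[R[i]]_n) :
  psdmx A -> psdmx (V *m A *m adjm V).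
Proof.
move=> [hA pA]; split; first by rewrite !adjmM adjmK -hA mulmxA.
move=> v; have := pA (adjm V *m v).
by rewrite adjmM adjmK !mulmxA.
Qed.

(** Restricting the quadratic form to two basis vectors turns positivity into scalar inequalities
    between entries. The case [j = k] is allowed and yields the diagonal entries. *)
Lemma delta_adj_form (R : realType) n (A : 'M[R[i]]_n) j k (a b : R[i])
    (v : 'cV[R[i]]_n := a *: delta_mx j 0 + b *: delta_mx k 0) :
  (adjm v *m A *m v) 0 0 =
  a^* * a * A j j + a^* * b * A j k + (b^* * a * A k j + b^* * b * A k k).
Proof.
have adjd l : adjm (delta_mx l 0 : 'cV[R[i]]_n) = delta_mx 0 l.
  by apply/matrixP => x y; rewrite adjmE !mxE conjC_nat andbC.
have E l l' : delta_mx 0 l *m A *m delta_mx l' 0 = (A l l')%:M :> 'M[R[i]]_1.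
  by rewrite -rowE -colE; apply/matrixP => x y; rewrite !ord1 !mxE.
rewrite /v adjmD !adjmZ !adjd !mulmxDl !mulmxDr -!scalemxAl -!scalemxAr.
by rewrite !E !mxE !mulr1n; ring.
Qed.

Lemma psdmx_diag_ge0 (R : realType) n (A : 'M[R[i]]_n) j : psdmx A -> 0 <= A j j.
Proof.
move=> [_ /(_ (1 *: delta_mx j 0 + 0 *: delta_mx j 0))].
by rewrite delta_adj_form rmorph0 rmorph1 !mul0r !mulr0 !mul0r !addr0 !mul1r.
Qed.

(** This is Cauchy-Schwarz for the semidefinite form of [A]; for a state it bounds a coherence by
    the populations of its two levels. *)
Lemma psdmx_minor2 (R : realType) n (A : 'M[R[i]]_n) j k : psdmx A ->
  cmod (A j k) ^+ 2 <= complex.Re (A j j) * complex.Re (A k k).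
Proof.
move=> pA; have [hA qA] := pA.
have := psdmx_diag_ge0 j pA; have := psdmx_diag_ge0 k pA.
(* The form at [r e_j - conj (A j k) e_k] is a quadratic polynomial in [r];
   evaluate it at [r = A k k], or at a small [r] when [A k k = 0]. *)
have q r := qA (RtoC r *: delta_mx j 0 + (- (A j k)^*) *: delta_mx k 0).
have Akj : A k j = (A j k)^* by rewrite {1}hA adjmE.
have zz : A j k * (A j k)^* = RtoC (cmod (A j k) ^+ 2) by exact: mulC_conj_cmod.
move: (cmod _ ^+ 2) (sqr_ge0 (cmod (A j k))) zz => z z0 zz.
have conjN : (- (A j k)^*)^* = - A j k by rewrite rmorphN /= conjCK.
have {}q r : 0 <= r ^+ 2 * complex.Re (A j j) - (r * z + r * z)
               + z * complex.Re (A k k).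
  rewrite -RtoC_ge0; move: (q r); rewrite delta_adj_form Akj.
  rewrite -(RtoC_Re (psdmx_diag_ge0 j pA)) -(RtoC_Re (psdmx_diag_ge0 k pA)).
  rewrite !(RtoCD, RtoCN, RtoCM) -zz conjN conjC_RtoC; congr (_ <= _).
  by rewrite /=; ring.
rewrite !lecE => /andP[_ /= b0] /andP[_ /= a0].
move: (complex.Re (A j j)) (complex.Re (A k k)) a0 b0 q => a b a0 b0 q.
have [b_gt0|] := ltP 0 b.
  have := q b; rewrite (_ : _ + _ = b * (a * b - z)); last by ring.
  by rewrite pmulr_rge0 // subr_ge0.
move=> ble0; have b_eq0 : b = 0 by apply/le_anti; rewrite ble0 b0.
rewrite b_eq0 mulr0.
(* With [b = 0] the polynomial is [r^2 a - 2 r z]; at this [r] it equals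
   [- z^2 (a + 2) / (a + 1)^2], so nonnegativity forces [z = 0]. The shift by 1 keeps the
   denominator positive when [a = 0]. *)
have := q (z / (a + 1)); rewrite b_eq0 mulr0 addr0.
have a1 : 0 < a + 1 by rewrite ltr_wpDl.
rewrite (_ : _ - _ = - (z ^+ 2 * ((a + 2) / (a + 1) ^+ 2))); last first.
  by field; rewrite gt_eqF.
rewrite oppr_ge0 pmulr_lle0; last first.
  by rewrite divr_gt0 ?exprn_gt0 // ltr_wpDl.
move=> z2; rewrite le_eqVlt; apply/orP; left.
by rewrite -sqrf_eq0 eq_le z2 sqr_ge0.
Qed.

(** * Matrix exponentials of Hermitian matrices *)

Definition cis (R : realType) (x : R) : R[i] := Complex (cos x) (sin x).

Lemma cisD (R : realType) (x y : R) : cis (x + y) = cis x * cis y.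
Proof.
apply/eqP; rewrite eq_complex /= cosD sinD eqxx /=.
by rewrite [sin x * _]mulrC [cos x * sin y]mulrC addrC [sin y * _]mulrC [cos y * _]mulrC.
Qed.

Lemma cis0 (R : realType) : cis (0 : R) = 1.
Proof. by rewrite /cis cos0 sin0. Qed.

Lemma conj_cis (R : realType) (x : R) : (cis x)^* = cis (- x).
Proof. by rewrite /cis cosN sinN. Qed.

(** Convergence is taken componentwise to match [expm], which takes separate limits of real and
    imaginary parts. *)
Definition ccvg (R : realType) (u : nat -> R[i]) (l : R[i]) : Prop :=
  ((fun N => complex.Re (u N)) @ \oo --> complex.Re l) /\
  ((fun N => complex.Im (u N)) @ \oo --> complex.Im l).

Lemma complex_ReD (R : realType) (x y : R[i]) :
  complex.Re (x + y) = complex.Re x + complex.Re y.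
Proof. by case: x y => [? ?] [? ?]. Qed.

Lemma complex_ImD (R : realType) (x y : R[i]) :
  complex.Im (x + y) = complex.Im x + complex.Im y.
Proof. by case: x y => [? ?] [? ?]. Qed.

Lemma complex_ReM (R : realType) (x y : R[i]) :
  complex.Re (x * y) =
  complex.Re x * complex.Re y - complex.Im x * complex.Im y.
Proof. by case: x y => [? ?] [? ?]. Qed.

Lemma complex_ImM (R : realType) (x y : R[i]) :
  complex.Im (x * y) =
  complex.Re x * complex.Im y + complex.Im x * complex.Re y.
Proof. by case: x y => [? ?] [? ?]. Qed.

Lemma ccvgD (R : realType) (u v : nat -> R[i]) (l m : R[i]) :
  ccvg u l -> ccvg v m -> ccvg (fun N => u N + v N) (l + m).
Proof.
move=> [ur ui] [vr vi]; split.
  by rewrite complex_ReD; under eq_fun do rewrite complex_ReD; exact: cvgD.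
by rewrite complex_ImD; under eq_fun do rewrite complex_ImD; exact: cvgD.
Qed.

Lemma ccvgZ (R : realType) (c : R[i]) (u : nat -> R[i]) (l : R[i]) :
  ccvg u l -> ccvg (fun N => c * u N) (c * l).
Proof.
move=> [ur ui]; split.
  rewrite complex_ReM; under eq_fun do rewrite complex_ReM.
  by apply: cvgB; apply: cvgM => //; exact: cvg_cst.
rewrite complex_ImM; under eq_fun do rewrite complex_ImM.
by apply: cvgD; apply: cvgM => //; exact: cvg_cst.
Qed.

Lemma ccvg_sum (R : realType) (I : Type) (s : seq I) (u : I -> nat -> R[i])
    (l : I -> R[i]) :
  (forall i, ccvg (u i) (l i)) ->
  ccvg (fun N => \sum_(i <- s) u i N) (\sum_(i <- s) l i).
Proof.
move=> ul; elim: s => [|i s IH].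
  rewrite big_nil; under eq_fun do rewrite big_nil.
  by split; exact: cvg_cst.
rewrite big_cons; under eq_fun do rewrite big_cons.
exact: ccvgD.
Qed.

(** The two components are written exactly as the sign factors in [cos_coeff] and [sin_coeff]. *)
Lemma expr_iC (R : realType) k : iC R ^+ k =
  Complex ((~~ odd k)%:R * (-1) ^+ k./2) ((odd k)%:R * (-1) ^+ k.-1./2).
Proof.
elim: k => [|k IH]; first by rewrite expr0 /= mul0r mulr1.
rewrite exprS IH /iC; apply/eqP; rewrite eq_complex /=. rewrite !mul0r !mul1r !add0r.
rewrite negbK eqxx andbT; case: (boolP (odd k)) => ok; last by rewrite !mul0r oppr0.
rewrite !mul1r.
case: k ok {IH} => // k /= ok; by rewrite exprS mulN1r.
Qed.

Lemma exp_iC_coeff (R : realType) (x : R) k :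
  (k`!%:R)^-1 * (iC R * RtoC x) ^+ k = Complex (cos_coeff x k) (sin_coeff x k).
Proof.
have -> : (k`!%:R : R[i])^-1 = RtoC (k`!%:R)^-1.
  by rewrite -[RtoC _]/(real_complex R _) fmorphV rmorph_nat.
have -> : RtoC x = real_complex R x by [].
rewrite exprMn -rmorphXn /= expr_iC /cos_coeff /sin_coeff /=.
apply/eqP; rewrite eq_complex /= !mulr0 !mul0r subr0 !addr0 !add0r.
by rewrite subr0 -exprnP ![_^-1 * _]mulrC !eqxx.
Qed.

Lemma ccvg_cis (R : realType) (x : R) :
  ccvg (fun N => \sum_(k < N) (k`!%:R)^-1 * (iC R * RtoC x) ^+ k) (cis x).
Proof.
have E N : \sum_(k < N) (k`!%:R)^-1 * (iC R * RtoC x) ^+ k =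
    Complex (series (cos_coeff x) N) (series (sin_coeff x) N).
  rewrite /series /= !big_mkord; elim: N => [|N IH]; first by rewrite !big_ord0.
  by rewrite !big_ord_recr /= IH exp_iC_coeff.
split; under eq_fun do rewrite E.
  (* Once unlocked, [cos x] is the limit of its series, so convergence of the series is the whole
     claim; [sin] is alike. *)
  by rewrite /cis /= unlock; exact: is_cvg_series_cos_coeff.
by rewrite /cis /= unlock; exact: is_cvg_series_sin_coeff.
Qed.

(** Spectral theorem. [spectralmx] holds the eigenvectors as rows in adjoint form, so its adjoint
    [U] has them as columns; hermiticity makes the eigenvalues real. *)
Lemma hermitian_decomp (R : realType) n (H : 'M[R[i]]_n) : hermitian_mx H ->
  exists (U : 'M[R[i]]_n) (e : 'I_n -> R),
    [/\ adjm U *m U = 1, U *m adjm U = 1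
      & H = U *m diag_mx (\row_j RtoC (e j)) *m adjm U].
Proof.
move=> hH.
have hs : H \is hermsymmx.
  by apply/is_hermitianmxP; rewrite expr0 scale1r {1}hH /adjm map_trmx.
have uS := spectral_unitarymx H.
have adjS : adjm (spectralmx H) = invmx (spectralmx H).
  by rewrite invmx_unitary // /adjm map_trmx.
exists (adjm (spectralmx H)), (fun j => complex.Re (spectral_diag H 0 j)); split.
- by rewrite adjmK adjS mulmxV // spectral_unit.
- by rewrite adjmK adjS mulVmx // spectral_unit.
have /orthomx_spectralP {1}-> := hermitian_normalmx hs.
rewrite adjmK adjS; congr (_ *m diag_mx _ *m _); apply/rowP => j; rewrite mxE.
have /mxOverP/(_ 0 j) := hermitian_spectral_diag_real hs.
by move=> /RRe_real.
Qed.

Lemma conj_diag_exp (R : realType) n (U : 'M[R[i]]_n) (z : 'I_n -> R[i]) k :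
  adjm U *m U = 1 -> U *m adjm U = 1 ->
  (U *m diag_mx (\row_j z j) *m adjm U) ^+ k =
  U *m diag_mx (\row_j z j ^+ k) *m adjm U.
Proof.
move=> UU UU'; elim: k => [|k IH].
  rewrite expr0 (_ : diag_mx _ = 1%:M) ?mulmx1 ?UU' //.
  by apply/matrixP => i j; rewrite !mxE expr0.
rewrite exprS IH -[_ * _]/(_ *m _) !mulmxA.
rewrite -[_ *m adjm U *m U]mulmxA UU mulmx1.
rewrite -[_ *m diag_mx _ *m diag_mx _]mulmxA mulmx_diag; congr (_ *m diag_mx _ *m _).
by apply/rowP => j; rewrite !mxE exprS.
Qed.

(** Each entry is a finite combination of the [z j] with coefficients free of [z], so limits can be
    taken on the diagonal alone. *)
Lemma conj_diagE (R : realType) n (U : 'M[R[i]]_n) (z : 'I_n -> R[i]) a b :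
  (U *m diag_mx (\row_j z j) *m adjm U) a b =
  \sum_j U a j * (U b j)^* * z j.
Proof.
rewrite mxE; apply: eq_bigr => j _.
by rewrite mul_mx_diag adjmE !mxE mulrAC.
Qed.

(** Powers act on the diagonal factor only, so after exchanging the two finite sums each entry is a
    fixed combination of scalar exponential series, which converge to [cis]. *)
Lemma expm_conj_diag (R : realType) n (U : 'M[R[i]]_n) (e : 'I_n -> R) (t : R) :
  adjm U *m U = 1 -> U *m adjm U = 1 ->
  expm ((iC R * RtoC t) *: (U *m diag_mx (\row_j RtoC (e j)) *m adjm U)) =
  U *m diag_mx (\row_j cis (t * e j)) *m adjm U.
Proof.
move=> UU UU'.
have -> : (iC R * RtoC t) *: (U *m diag_mx (\row_j RtoC (e j)) *m adjm U) =
    U *m diag_mx (\row_j (iC R * RtoC (t * e j))) *m adjm U.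
  rewrite scalemxAl scalemxAr; congr (_ *m _ *m _).
  apply/matrixP => i j; rewrite !mxE RtoCM mulrA.
  by case: eqP => _; rewrite ?mulr1n // !mulr0n mulr0.
apply/matrixP => a b; rewrite mxE.
have [cvgr cvgi] : ccvg (fun N => (\sum_(k < N) (k`!%:R)^-1 *:
      (U *m diag_mx (\row_j (iC R * RtoC (t * e j))) *m adjm U) ^+ k) a b)
    ((U *m diag_mx (\row_j cis (t * e j)) *m adjm U) a b).
  rewrite conj_diagE; under eq_fun => N.
    rewrite summxE; under eq_bigr => k _.
      rewrite mxE conj_diag_exp // conj_diagE mulr_sumr.
      under eq_bigr do rewrite mulrCA. over.
    rewrite exchange_big /=; under eq_bigr do rewrite -mulr_sumr.
  over.
  by apply: ccvg_sum => j; apply: ccvgZ; exact: ccvg_cis.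
by rewrite (cvg_lim _ cvgr) // (cvg_lim _ cvgi) //; case: (_ a b).
Qed.

(** * Expectations of random matrices *)

(** [cexpect] integrates the two components separately, so linearity of the expectation calls for
    integrability of each. *)
Definition cintegrable (R : realType) d (T : measurableType d)
    (P : probability T R) (f : T -> R[i]) : Prop :=
  P.-integrable setT (EFin \o (fun w => complex.Re (f w))) /\
  P.-integrable setT (EFin \o (fun w => complex.Im (f w))).

Lemma cintegrableD (R : realType) d (T : measurableType d)
    (P : probability T R) (f g : T -> R[i]) :
  cintegrable P f -> cintegrable P g -> cintegrable P (fun w => f w + g w).
Proof.
move=> [fr fi] [gr gi]; split.
  have := integrableD measurableT fr gr; apply: eq_integrable => // w _.
  by rewrite /= complex_ReD.
have := integrableD measurableT fi gi; apply: eq_integrable => // w _.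
by rewrite /= complex_ImD.
Qed.

Lemma cintegrableZ (R : realType) d (T : measurableType d)
    (P : probability T R) (c : R[i]) (f : T -> R[i]) :
  cintegrable P f -> cintegrable P (fun w => c * f w).
Proof.
move=> [fr fi].
have Z k g := @integrableZl _ T R P setT measurableT k g.
split.
  have := integrableB measurableT (Z (complex.Re c) _ fr) (Z (complex.Im c) _ fi).
  by apply: eq_integrable => // w _; rewrite /= complex_ReM EFinB.
have := integrableD measurableT (Z (complex.Re c) _ fi) (Z (complex.Im c) _ fr).
by apply: eq_integrable => // w _; rewrite /= complex_ImM EFinD.
Qed.

Lemma cintegrable_sum (R : realType) d (T : measurableType d)
    (P : probability T R) (I : Type) (s : seq I) (f : I -> T -> R[i]) :
  (forall i, cintegrable P (f i)) ->
  cintegrable P (fun w => \sum_(i <- s) f i w).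
Proof.
move=> fP; elim: s => [|i s IH].
  by under eq_fun do rewrite big_nil; split; exact: integrable0.
by under eq_fun do rewrite big_cons; exact: cintegrableD.
Qed.

Lemma cexpectD (R : realType) d (T : measurableType d)
    (P : probability T R) (f g : T -> R[i]) :
  cintegrable P f -> cintegrable P g ->
  cexpect P (fun w => f w + g w) = cexpect P f + cexpect P g.
Proof.
move=> [fr fi] [gr gi]; rewrite /cexpect.
under eq_Rintegral do rewrite complex_ReD.
under [X in Complex _ X]eq_Rintegral do rewrite complex_ImD.
by rewrite !RintegralD.
Qed.

Lemma cexpectZ (R : realType) d (T : measurableType d)
    (P : probability T R) (c : R[i]) (f : T -> R[i]) :
  cintegrable P f -> cexpect P (fun w => c * f w) = c * cexpect P f.
Proof.
move=> [fr fi]; rewrite /cexpect.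
have Z k g := @integrableZl _ T R P setT measurableT k g.
under eq_Rintegral do rewrite complex_ReM.
under [X in Complex _ X]eq_Rintegral do rewrite complex_ImM.
rewrite RintegralB ?RintegralD ?RintegralZl //; first by case: c.
all: by [exact: (Z _ _ fr) | exact: (Z _ _ fi)].
Qed.

Lemma cexpect_sum (R : realType) d (T : measurableType d)
    (P : probability T R) (I : Type) (s : seq I) (f : I -> T -> R[i]) :
  (forall i, cintegrable P (f i)) ->
  cexpect P (fun w => \sum_(i <- s) f i w) = \sum_(i <- s) cexpect P (f i).
Proof.
move=> fP; elim: s => [|i s IH].
  rewrite big_nil /cexpect; under eq_Rintegral do rewrite big_nil /=.
  under [X in Complex _ X]eq_Rintegral do rewrite big_nil /=.
  by rewrite !Rintegral_cst //= mul0r.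
rewrite big_cons -IH -cexpectD //; last exact: cintegrable_sum.
by congr cexpect; apply/funext => w; rewrite big_cons.
Qed.

Lemma cexpect_cst (R : realType) d (T : measurableType d)
    (P : probability T R) (c : R[i]) : cexpect P (fun=> c) = c.
Proof.
by rewrite /cexpect !Rintegral_cst //= probability_setT /= !mulr1; case: c.
Qed.

Lemma cexpect_ge0 (R : realType) d (T : measurableType d)
    (P : probability T R) (f : T -> R[i]) :
  (forall w, 0 <= f w) -> 0 <= cexpect P f.
Proof.
move=> f0; rewrite lecE /=; apply/andP; split.
  apply/eqP; transitivity (\int[P]_w (0 : R)); last by rewrite Rintegral_cst ?mul0r.
  by apply: eq_Rintegral => w _; have := f0 w; rewrite lecE => /andP[/eqP].
by apply: Rintegral_ge0 => w _; have := f0 w; rewrite lecE => /andP[].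
Qed.

Lemma cexpect_conj (R : realType) d (T : measurableType d)
    (P : probability T R) (f : T -> R[i]) :
  cintegrable P f -> cexpect P (fun w => (f w)^* ) = (cexpect P f)^*.
Proof.
move=> [_ fi]; rewrite /cexpect /=; apply/eqP; rewrite eq_complex /=; apply/andP; split.
  by apply/eqP; apply: eq_Rintegral => w _; case: (f w).
rewrite -mulN1r -RintegralZl //; apply/eqP; apply: eq_Rintegral => w _.
by case: (f w) => a b /=; rewrite mulN1r.
Qed.

Lemma cintegrable_cis (R : realType) d (T : measurableType d)
    (P : probability T R) (X : {RV P >-> R}) (a : R) :
  cintegrable P (fun w => cis (a * X w)).
Proof.
have mX : measurable_fun setT (fun w => a * X w).
  by apply: measurableT_comp => //; exact: mulrl_measurable.
have PT : (P setT < +oo)%E by rewrite probability_setT ltry.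
split; apply: measurable_bounded_integrable => //=.
- by apply: measurableT_comp mX; apply: continuous_measurable_fun; exact: continuous_cos.
- by exists 1; split => // M M1 w _ /=; apply: le_trans (ltW M1); exact: cos_max.
- by apply: measurableT_comp mX; apply: continuous_measurable_fun; exact: continuous_sin.
- by exists 1; split => // M M1 w _ /=; apply: le_trans (ltW M1); exact: sin_max.
Qed.

Definition mintegrable (R : realType) d (T : measurableType d)
    (P : probability T R) m (F : T -> 'M[R[i]]_m) : Prop :=
  forall a b, cintegrable P (fun w => F w a b).

Lemma mexpectE (R : realType) d (T : measurableType d)
    (P : probability T R) m (F : T -> 'M[R[i]]_m) a b :
  mexpect P F a b = cexpect P (fun w => F w a b).
Proof. by rewrite mxE. Qed.

(** The form at a fixed [v] is linear in the matrix; this carries positivity from the samples to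
    their mean. *)
Lemma mexpect_form (R : realType) d (T : measurableType d)
    (P : probability T R) m (F : T -> 'M[R[i]]_m) (v : 'cV[R[i]]_m) :
  mintegrable P F ->
  (adjm v *m mexpect P F *m v) 0 0 = cexpect P (fun w => (adjm v *m F w *m v) 0 0).
Proof.
move=> iF.
have E (A : 'M[R[i]]_m) : (adjm v *m A *m v) 0 0 =
    \sum_b \sum_a (v b 0 * adjm v 0 a) * A a b.
  rewrite mxE; apply: eq_bigr => b _; rewrite mxE mulr_suml.
  by apply: eq_bigr => a _; rewrite mulrC mulrA.
rewrite E; under [X in cexpect P X]eq_fun do rewrite E.
have iZ a b : cintegrable P (fun w => v b 0 * adjm v 0 a * F w a b).
  exact: cintegrableZ.
rewrite cexpect_sum; last by move=> b; apply: cintegrable_sum => a; exact: iZ.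
apply: eq_bigr => b _; rewrite cexpect_sum; last by move=> a; exact: iZ.
by apply: eq_bigr => a _; rewrite cexpectZ ?mexpectE //; exact: iF.
Qed.

Lemma mexpect_psd (R : realType) d (T : measurableType d)
    (P : probability T R) m (F : T -> 'M[R[i]]_m) :
  mintegrable P F -> (forall w, psdmx (F w)) -> psdmx (mexpect P F).
Proof.
move=> iF pF; split.
  apply/matrixP => a b; rewrite adjmE !mxE -cexpect_conj //.
  by congr cexpect; apply/funext => w; have [hF _] := pF w; rewrite [in LHS]hF adjmE.
by move=> v; rewrite mexpect_form //; apply: cexpect_ge0 => w; have [_] := pF w.
Qed.

Lemma adjm_mxdiag (R : realType) n m (W : 'M[R[i]]_n) :
  adjm (\mxdiag_(i < m) W) = \mxdiag_(i < m) adjm W.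
Proof.
rewrite /adjm map_trmx tr_mxdiag; apply/matrixP => s t; rewrite !mxE /=.
by case: eqP => e; rewrite ?mxE ?conjC0 // !conform_mx_id !mxE.
Qed.

Lemma addZmxE (R : pzRingType) m n (c : R) (A B : 'M[R]_(m, n)) a b :
  (c *: A + B) a b = c * A a b + B a b.
Proof. by rewrite mxE [X in X + _]mxE. Qed.

(** Everything holds samplewise and survives averaging: cyclicity gives the trace, and applying the
    conjugation blockwise is conjugation by the block diagonal matrix with all blocks [W w], which
    preserves positivity. *)
Lemma random_unitary_quantum_operation (R : realType) d (T : measurableType d)
    (P : probability T R) n (W : T -> 'M[R[i]]_n) :
  (forall w, adjm (W w) *m W w = 1) ->
  (forall A, mintegrable P (fun w => W w *m A *m adjm (W w))) ->
  quantum_operation (fun A => mexpect P (fun w => W w *m A *m adjm (W w))).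
Proof.
move=> WW iW; split.
- move=> c A B; apply/matrixP => a b.
  have E w : (W w *m (c *: A + B) *m adjm (W w)) a b =
      c * (W w *m A *m adjm (W w)) a b + (W w *m B *m adjm (W w)) a b.
    by rewrite mulmxDr mulmxDl -scalemxAr -scalemxAl addZmxE.
  have iA := iW A a b; have iB := iW B a b.
  rewrite mexpectE (funext E) (cexpectD (cintegrableZ c iA) iB) (cexpectZ c iA).
  by rewrite addZmxE; congr (_ * _ + _); rewrite [RHS]mexpectE.
- move=> A; rewrite /mxtrace; under eq_bigr do rewrite mexpectE.
  rewrite -cexpect_sum //; last by move=> i; exact: iW.
  under eq_fun => w.
    rewrite -[\sum_(i <- _) _]/(\tr (W w *m A *m adjm (W w))) mxtrace_mulC mulmxA WW mul1mx.
  over.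
  exact: cexpect_cst.
move=> m B pB.
have -> : \mxblock_(i < m, j < m) mexpect P (fun w => W w *m B i j *m adjm (W w)) =
    mexpect P (fun w => \mxblock_(i < m, j < m) (W w *m B i j *m adjm (W w))).
  apply/matrixP => s t; rewrite [LHS]mxE [RHS]mexpectE [LHS]mexpectE.
  by congr cexpect; apply/funext => w; rewrite [RHS]mxE.
apply: mexpect_psd => [s t|w].
  have := iW (B (tagnat.sig1 s) (tagnat.sig1 t)) (tagnat.sig2 s) (tagnat.sig2 t).
  by congr cintegrable; apply/funext => w; rewrite [RHS]mxE.
by rewrite -mul_mxblock_mxdiag -mul_mxdiag_mxblock -adjm_mxdiag; exact: psdmx_conj.
Qed.

(** * The dephasing channel in the eigenbasis *)

Lemma adjm_conj_diag (R : realType) n (U : 'M[R[i]]_n) (z : 'I_n -> R[i]) :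
  adjm (U *m diag_mx (\row_j z j) *m adjm U) =
  U *m diag_mx (\row_j (z j)^*) *m adjm U.
Proof.
rewrite !adjmM adjmK mulmxA; congr (_ *m _ *m _).
by apply/matrixP => j k; rewrite adjmE !mxE rmorphMn /= eq_sym; case: eqP => [->|].
Qed.

(** Entrywise multiplication by [G] in the basis of the columns of [U]. Evolution by a fixed time
    and its average over [T] both have this form. *)
Definition schur_multiplier (R : realType) n (U : 'M[R[i]]_n)
    (G : 'I_n -> 'I_n -> R[i]) (A : 'M[R[i]]_n) : 'M[R[i]]_n :=
  U *m (\matrix_(j, k) (G j k * (adjm U *m A *m U) j k)) *m adjm U.

Lemma schur_multiplierE (R : realType) n (U : 'M[R[i]]_n)
    (G : 'I_n -> 'I_n -> R[i]) (A : 'M[R[i]]_n) a b :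
  schur_multiplier U G A a b = \sum_k \sum_j
    U a j * (adjm U *m A *m U) j k * (U b k)^* * G j k.
Proof.
rewrite /schur_multiplier; move: (adjm U *m A *m U) => B.
rewrite mxE; apply: eq_bigr => k _; rewrite mxE mulr_suml.
by apply: eq_bigr => j _; rewrite adjmE mxE; ring.
Qed.

Lemma charfunE (R : realType) d (T : measurableType d) (P : probability T R)
    (X : {RV P >-> R}) (a : R) : charfun X a = cexpect P (fun w => cis (a * X w)).
Proof. by []. Qed.

(** Conjugating a phase negates its frequency. Hence the multiplier of [RT] is Hermitian and the
    sign of an energy difference does not affect the modulus. *)
Lemma charfunN (R : realType) d (T : measurableType d) (P : probability T R)
    (X : {RV P >-> R}) (a : R) : charfun X (- a) = (charfun X a)^*.
Proof.
rewrite /charfun -[in RHS]cexpect_conj; last exact: cintegrable_cis.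
by congr cexpect; apply/funext => w; rewrite conj_cis mulNr.
Qed.

Lemma charfun0 (R : realType) d (T : measurableType d) (P : probability T R)
    (X : {RV P >-> R}) : charfun X 0 = 1.
Proof.
rewrite -[RHS](cexpect_cst P); congr cexpect; apply/funext => w.
by rewrite mul0r; exact: cis0.
Qed.

(** In the eigenbasis the entry (j, k) picks up the phase of [e j] from the left and the conjugate
    phase of [e k] from the right. *)
Lemma conj_evolution (R : realType) n (U : 'M[R[i]]_n) (e : 'I_n -> R)
    (x : R) (A : 'M[R[i]]_n) :
  let W := U *m diag_mx (\row_j cis (- x * e j)) *m adjm U in
  W *m A *m adjm W = schur_multiplier U (fun j k => cis ((e k - e j) * x)) A.
Proof.
rewrite /= adjm_conj_diag /schur_multiplier.
set D := diag_mx _; set D' := diag_mx _.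
have -> : U *m D *m adjm U *m A *m (U *m D' *m adjm U) =
    U *m (D *m (adjm U *m A *m U) *m D') *m adjm U by rewrite !mulmxA.
move: (adjm U *m A *m U) => B; congr (_ *m _ *m _); apply/matrixP => j k.
rewrite mul_mx_diag mxE mul_diag_mx !mxE conj_cis mulrAC -cisD.
by congr (cis _ * _); ring.
Qed.

Lemma RT_spectral (R : realType) n (H U : 'M[R[i]]_n) (e : 'I_n -> R)
    d (T : measurableType d) (P : probability T R) (X : {RV P >-> R}) :
  adjm U *m U = 1 -> U *m adjm U = 1 ->
  H = U *m diag_mx (\row_j RtoC (e j)) *m adjm U ->
  quantum_operation (RT X H) /\
  forall A, RT X H A = schur_multiplier U (fun j k => charfun X (e k - e j)) A.
Proof.
move=> UU UU' HE.
pose W w := U *m diag_mx (\row_j cis (- X w * e j)) *m adjm U.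
(* Both exponentials come from [expm_conj_diag], at the times [- X w] and [X w]; the second is the
   adjoint of the first because its phases are the conjugates. *)
have RTE : RT X H = fun A => mexpect P (fun w => W w *m A *m adjm (W w)).
  apply/funext => A; congr mexpect; apply/funext => w.
  rewrite /W adjm_conj_diag HE -expm_conj_diag // RtoCN mulrN; congr (_ *m _).
  rewrite expm_conj_diag //; congr (_ *m diag_mx _ *m _).
  by apply/rowP => j; rewrite !mxE conj_cis mulNr opprK.
have WAW w A : W w *m A *m adjm (W w) =
    schur_multiplier U (fun j k => cis ((e k - e j) * X w)) A.
  exact: conj_evolution.
have iW A : mintegrable P (fun w => W w *m A *m adjm (W w)).
  move=> a b; under eq_fun do rewrite WAW schur_multiplierE.
  do 2 (apply: cintegrable_sum => ?).
  by apply: cintegrableZ; exact: cintegrable_cis.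
have WW w : adjm (W w) *m W w = 1.
  rewrite /W adjm_conj_diag !mulmxA -[_ *m adjm U *m U]mulmxA UU mulmx1.
  rewrite -[_ *m diag_mx _ *m diag_mx _]mulmxA mulmx_diag.
  set D := diag_mx _; have -> : D = 1%:M; last by rewrite mulmx1 UU'.
  by apply/matrixP => j k; rewrite !mxE conj_cis -cisD addNr cis0.
split; first by rewrite RTE; exact: (random_unitary_quantum_operation WW iW).
move=> A; rewrite RTE; apply/matrixP => a b; rewrite [LHS]mexpectE schur_multiplierE.
under [X in cexpect P X]eq_fun do rewrite WAW schur_multiplierE.
rewrite cexpect_sum; last first.
  move=> k; apply: cintegrable_sum => j.
  by apply: cintegrableZ; exact: cintegrable_cis.
apply: eq_bigr => k _; rewrite cexpect_sum; last first.
  by move=> j; apply: cintegrableZ; exact: cintegrable_cis.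
apply: eq_bigr => j _; rewrite charfunE.
exact: (cexpectZ _ (cintegrable_cis X _)).
Qed.

(** * Distance to the ideal measurement *)

Lemma cmodM (R : realType) (x y : R[i]) : cmod (x * y) = cmod x * cmod y.
Proof.
have E (z : R[i]) : cmod z = ComplexField.Normc.normc z by case: z.
by rewrite !E ComplexField.Normc.normcM.
Qed.

Lemma cmodN (R : realType) (x : R[i]) : cmod (- x) = cmod x.
Proof. by case: x => a b; rewrite /cmod /= !sqrrN. Qed.

Lemma cmod_conj (R : realType) (x : R[i]) : cmod x^* = cmod x.
Proof. by case: x => a b; rewrite /cmod /= sqrrN. Qed.

Lemma Re_adjm_mul (R : realType) n (u : 'cV[R[i]]_n) :
  complex.Re ((adjm u *m u) 0 0) = \sum_j cmod (u j 0) ^+ 2.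
Proof.
rewrite mxE; apply: (can_inj (fun x : R => erefl (complex.Re (RtoC x)))).
rewrite RtoC_Re; last by rewrite sumr_ge0 // => j _; rewrite adjmE mulrC mul_conjC_ge0.
rewrite -[RHS]/(real_complex R _) rmorph_sum; apply: eq_bigr => j _.
by rewrite adjmE mulrC mulC_conj_cmod.
Qed.

(** In the coordinates [adjm U *m v] the eigenvalue equation reads [e j * w_j = l * w_j], and a
    nonzero [w_j] can be cancelled. *)
Lemma eigen_coord (R : realType) n (H U : 'M[R[i]]_n) (e : 'I_n -> R)
    (v : 'cV[R[i]]_n) (l : R) j :
  adjm U *m U = 1 -> H = U *m diag_mx (\row_j RtoC (e j)) *m adjm U ->
  H *m v = RtoC l *: v -> (adjm U *m v) j 0 != 0 -> e j = l.
Proof.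
move=> UU -> /(congr1 (mulmx (adjm U))).
rewrite !mulmxA UU mul1mx -scalemxAr -mulmxA => /matrixP/(_ j 0).
rewrite mul_diag_mx !mxE -!/(\sum__ _) => E vj0.
have := mulIf vj0 E.
by case.
Qed.

Lemma spectral_eigenvector (R : realType) n (H U : 'M[R[i]]_n) (e : 'I_n -> R) j :
  adjm U *m U = 1 -> H = U *m diag_mx (\row_j RtoC (e j)) *m adjm U ->
  H *m (U *m delta_mx j 0 : 'cV_n) = RtoC (e j) *: (U *m delta_mx j 0).
Proof.
move=> UU ->; rewrite -mulmxA [adjm U *m _]mulmxA UU mul1mx -mulmxA scalemxAr.
congr (_ *m _); apply/matrixP => k l; rewrite mul_diag_mx !mxE.
by case: eqP => [->|]; rewrite ?mulr0.
Qed.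

Lemma eigenvalue_spectral (R : realType) n (H U : 'M[R[i]]_n) (e : 'I_n -> R) l :
  adjm U *m U = 1 -> U *m adjm U = 1 ->
  H = U *m diag_mx (\row_j RtoC (e j)) *m adjm U ->
  is_eigenvalue H l <-> exists j, l = e j.
Proof.
move=> UU UU' HE; split=> [[v v0 Hv]|[j ->]].
  have : adjm U *m v != 0.
    apply: contra v0 => /eqP/(congr1 (mulmx U)).
    by rewrite mulmxA UU' mul1mx mulmx0 => ->.
  case/cV0Pn => j vj0; exists j; apply/esym.
  exact: (eigen_coord UU HE Hv).
exists (U *m delta_mx j 0); last exact: spectral_eigenvector.
apply/negP => /eqP /(congr1 (mulmx (adjm U))).
rewrite mulmxA UU mul1mx mulmx0 => /matrixP/(_ j 0); rewrite !mxE !eqxx /= => /eqP.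
by rewrite oner_eq0.
Qed.

(** Each column of [U] with eigenvalue [E] is a multiple of [psi], and [psi] has coordinates only
    along such columns. So exactly one index carries [E], and [psi] is that column up to a phase. *)
Lemma nondegenerate_spectral (R : realType) n (H U : 'M[R[i]]_n) (e : 'I_n -> R)
    (psi : 'cV[R[i]]_n) (E : R) :
  adjm U *m U = 1 -> U *m adjm U = 1 ->
  H = U *m diag_mx (\row_j RtoC (e j)) *m adjm U ->
  adjm psi *m psi = 1 -> H *m psi = RtoC E *: psi ->
  (forall v : 'cV[R[i]]_n, H *m v = RtoC E *: v -> exists c : R[i], v = c *: psi) ->
  exists j0, [/\ e j0 = E, forall j, j != j0 -> e j != E
    & Defs.projv psi = U *m diag_mx (\row_j (j == j0)%:R) *m adjm U].
Proof.
move=> UU UU' HE psi1 Hpsi nondeg.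
have [y yE] : exists y, adjm U *m psi = y by exists (adjm U *m psi).
have psiE : psi = U *m y by rewrite -yE mulmxA UU' mul1mx.
have coord j : e j = E -> exists c, delta_mx j 0 = c *: y.
  move=> ej; have := spectral_eigenvector j UU HE; rewrite ej.
  move=> /nondeg[c] /(congr1 (mulmx (adjm U))); rewrite mulmxA UU mul1mx -scalemxAr.
  by rewrite yE => ->; exists c.
have : y != 0.
  apply/eqP => y0; move: psi1; rewrite psiE y0 mulmx0 mulmx0 => /matrixP/(_ 0 0).
  by rewrite !mxE /= => /esym/eqP; rewrite oner_eq0.
case/cV0Pn => j0 yj0.
have ej j : y j 0 != 0 -> e j = E.
  by rewrite -yE; exact: (eigen_coord UU HE Hpsi).
have ej0 := ej _ yj0.
(* A second such index would give [delta_mx j 0 = c *: y]. Coordinate [j0] forces [c = 0], and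
   coordinate [j] then reads [1 = 0]. *)
have uniq j : j != j0 -> e j != E.
  move=> jj0; apply/eqP => /coord[c] /matrixP cy.
  have := cy j0 0; rewrite !mxE eq_sym (negbTE jj0) /= => /esym/eqP.
  rewrite mulf_eq0 (negbTE yj0) orbF => /eqP c0.
  have := cy j 0; rewrite c0 scale0r !mxE !eqxx /= => /eqP.
  by rewrite oner_eq0.
exists j0; split => //.
have yd : y = y j0 0 *: delta_mx j0 0.
  apply/matrixP => j k; rewrite ord1 !mxE.
  have [->|jj0] := eqVneq j j0; first by rewrite mulr1.
  rewrite mulr0; apply/eqP; apply: contraT => /ej ejE.
  by have := uniq _ jj0; rewrite ejE eqxx.
have yy : adjm y *m y = 1 by rewrite -yE adjmM adjmK mulmxA -[_ *m U *m _]mulmxA UU' mulmx1.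
(* The remaining coordinate is a pure phase, which cancels in the projector. *)
have norm1 : y j0 0 * (y j0 0)^* = 1.
  move: yy => /matrixP/(_ 0 0); rewrite mxE (bigD1 j0) //= big1 => [|j jj0].
    by rewrite addr0 adjmE mulrC => ->; rewrite mxE.
  by rewrite yd !mxE (negbTE jj0) !mulr0.
rewrite /Defs.projv psiE adjmM !mulmxA; congr (_ *m _); rewrite -mulmxA; congr (_ *m _).
apply/matrixP => j k; rewrite mxE big_ord1 adjmE yd !mxE.
rewrite rmorphM /= conjC_nat mulrACA norm1 mul1r -natrM eqxx !andbT.
have [->|jj0] := eqVneq j j0; last by rewrite mul0n mul0rn.
by rewrite eq_sym mul1n; case: eqP.
Qed.

(** Only column [j0] of [G] enters the bound: [G j0 j0 = 1] makes the [P] block agree, the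
    complementary block is treated alike by both maps, and hermiticity ties row [j0] to column
    [j0]. *)
Lemma trnorm_dephasing_le (R : realType) n (U : 'M[R[i]]_n)
    (G : 'I_n -> 'I_n -> R[i]) (F : 'M[R[i]]_n -> 'M[R[i]]_n)
    (psi : 'cV[R[i]]_n) (rho : 'M[R[i]]_n) (j0 : 'I_n) (eps : R) :
  adjm U *m U = 1 -> U *m adjm U = 1 ->
  Defs.projv psi = U *m diag_mx (\row_j (j == j0)%:R) *m adjm U ->
  (forall A, F A = schur_multiplier U G A) ->
  G j0 j0 = 1 -> (forall j k, G j k = (G k j)^*) ->
  0 <= eps -> (forall j, j != j0 -> cmod (G j j0) <= eps) ->
  is_state rho -> trnorm (ME psi F rho - F rho) <= eps.
Proof.
move=> UU UU' projE FE G1 GC eps0 Geps [psd_rho tr_rho].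
have [r rE] : exists r, adjm U *m rho *m U = r by exists (adjm U *m rho *m U).
have psd_r : psdmx r by have := psdmx_conj (adjm U) psd_rho; rewrite adjmK rE.
have tr_r : \tr r = 1 by rewrite -rE mxtrace_mulC mulmxA UU' mul1mx.
pose p : 'cV[R[i]]_n := U *m delta_mx j0 0.
(* Column [j0] of the difference in the eigenbasis: the coherences kept by [F] and erased by [ME],
   hence the minus sign. The zero at [j0] makes [u] orthogonal to [p]. *)
pose u0 : 'cV[R[i]]_n := \col_j (if j == j0 then 0 else - (G j j0 * r j j0)).
pose u := U *m u0.
have adj_delta : adjm (delta_mx j0 0 : 'cV[R[i]]_n) = delta_mx 0 j0.
  by apply/matrixP => x y; rewrite adjmE !mxE conjC_nat andbC.
have pp : adjm p *m p = 1.
  rewrite /p adjmM mulmxA -[_ *m adjm U *m U]mulmxA UU mulmx1 adj_delta mul_delta_mx.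
  by apply/matrixP => x y; rewrite !ord1 !mxE.
have pu : adjm p *m u = 0.
  rewrite /p /u adjmM mulmxA -[_ *m adjm U *m U]mulmxA UU mulmx1 adj_delta -rowE.
  by apply/matrixP => x y; rewrite !mxE eqxx.
have uu : adjm u *m u = adjm u0 *m u0.
  by rewrite /u adjmM mulmxA -[_ *m adjm U *m U]mulmxA UU mulmx1.
have QE : 1 - Defs.projv psi = U *m diag_mx (\row_j (j != j0)%:R) *m adjm U.
  rewrite projE -{1}UU' -{1}[U]mulmx1 -mulmxBl -mulmxBr; congr (_ *m _ *m _).
  apply/matrixP => j k; rewrite !mxE; case: (j =P k) => [_|_]; last by rewrite !mulr0n subr0.
  by case: eqP; rewrite /= ?subrr ?subr0.
have conjD (D : 'M[R[i]]_n) A : U *m D *m adjm U *m A *m (U *m D *m adjm U) =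
    U *m (D *m (adjm U *m A *m U) *m D) *m adjm U by rewrite !mulmxA.
have diagE (b : pred 'I_n) (A : 'M[R[i]]_n) j k :
    (diag_mx (\row_i (b i)%:R) *m A *m diag_mx (\row_i (b i)%:R)) j k =
    (b j)%:R * A j k * (b k)%:R by rewrite mul_mx_diag mxE mul_diag_mx !mxE.
have VK A : adjm U *m (U *m A *m adjm U) *m U = A.
  by rewrite !mulmxA UU mul1mx -mulmxA UU mulmx1.
have -> : ME psi F rho - F rho = u *m adjm p + p *m adjm u.
  rewrite /ME !FE QE projE !conjD /schur_multiplier VK rE.
  have -> : u *m adjm p + p *m adjm u =
      U *m (u0 *m delta_mx 0 j0 + delta_mx j0 0 *m adjm u0) *m adjm U.
    by rewrite /u /p !adjmM adj_delta mulmxDr mulmxDl !mulmxA.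
  rewrite -mulmxDl -mulmxDr -mulmxBl -mulmxBr; congr (_ *m _ *m _).
  apply/matrixP => j k.
  have addE (A B C : 'M[R[i]]_n) : (A + B - C) j k = A j k + B j k - C j k.
    by rewrite !mxE.
  have sumE : (u0 *m delta_mx 0 j0 + delta_mx j0 0 *m adjm u0) j k =
      u0 j 0 * (k == j0)%:R + (j == j0)%:R * (u0 k 0)^*.
    by rewrite mxE mxE [X in _ + X]mxE !big_ord1 !mxE !eqxx !andbT.
  rewrite addE sumE diagE [(\matrix_(_, _) _) j k]mxE diagE [(\matrix_(_, _) _) j k]mxE.
  rewrite !mxE.
  have rC l m : r l m = (r m l)^* by have [hr _] := psd_r; rewrite {1}hr adjmE.
  (* In order: the population of [psi], row [j0], column [j0], and the complementary block. *)
  have [->|jj0] := eqVneq j j0; have [->|kj0] := eqVneq k j0 => /=.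
  - by rewrite G1 conjC0 !(mul1r, mulr1, mul0r, mulr0); ring.
  - by rewrite [G j0 k]GC [r j0 k]rC rmorphN rmorphM /=; ring.
  - by rewrite conjC0; ring.
  - by ring.
apply: le_trans (trnorm_rank2_le pp pu) _.
rewrite uu Re_adjm_mul.
(* The target [2 |u| <= eps] in squared form. *)
suff : \sum_j cmod (u0 j 0) ^+ 2 <= (eps / 2) ^+ 2.
  by rewrite -ler_sqrt ?sqr_ge0 // sqrtr_sqr ger0_norm ?divr_ge0 // ler_pdivlMr // mulrC.
have re1 : \sum_j complex.Re (r j j) = 1.
  have := congr1 (fun z : R[i] => complex.Re z) tr_r.
  by rewrite /mxtrace (big_morph (fun z : R[i] => complex.Re z) (@complex_ReD R) erefl).
rewrite (bigD1 j0) //= mxE eqxx /cmod /= !expr0n /= addr0 sqrtr0 expr0n add0r -/(cmod _).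
set a := complex.Re (r j0 j0).
apply: (@le_trans _ _ (\sum_(j | j != j0) eps ^+ 2 * (complex.Re (r j j) * a))).
  apply: ler_sum => j jj0; rewrite mxE (negbTE jj0) -/(cmod _) cmodN cmodM exprMn.
  apply: ler_pM; rewrite ?sqr_ge0 //; last exact: psdmx_minor2.
  by rewrite ler_sqr ?nnegrE ?sqrtr_ge0 // Geps.
rewrite -mulr_sumr -mulr_suml.
(* Unit trace turns the sum of the other populations into [1 - a], and [a (1 - a) <= 1/4] is
   [(a - 1/2)^2 >= 0]. *)
move: re1; rewrite (bigD1 j0) //= -/a => /eqP; rewrite addrC eq_sym -subr_eq => /eqP <-.
rewrite exprMn ler_wpM2l ?sqr_ge0 //.
by have := sqr_ge0 (a - 2^-1); rewrite -subr_ge0 => h; rewrite -subr_ge0; nra.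
Qed.

Theorem theorem1 (R : realType) (n : nat) (H : 'M[R[i]]_n)
  (psi : 'cV[R[i]]_n) (E : R)
  (d : measure_display) (T : measurableType d) (P : probability T R)
  (X : {RV P >-> R}) :
  hermitian_mx H ->
  adjm psi *m psi = 1 ->
  H *m psi = RtoC E *: psi ->
  (forall v : 'cV[R[i]]_n, H *m v = RtoC E *: v -> exists c : R[i], v = c *: psi) ->
  exists F : 'M[R[i]]_n -> 'M[R[i]]_n,
    quantum_operation F /\
    forall rho : 'M[R[i]]_n, is_state rho ->
      trnorm (ME psi F rho - RT X H rho)
        <= sup [set r : R | exists2 l : R,
                 is_eigenvalue H l /\ l != E & r = cmod (charfun X (l - E))].
Proof.
move=> /hermitian_decomp[U [e [UU UU' HE]]] psi1 Hpsi nondeg.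
have [j0 [ej0 nej0 projE]] := nondegenerate_spectral UU UU' HE psi1 Hpsi nondeg.
have [qRT RTE] := RT_spectral X UU UU' HE.
exists (RT X H); split => // rho st_rho.
set S := [set r | _].
have cmod_charfun j k : cmod (charfun X (e j - e k)) = cmod (charfun X (e k - e j)).
  by rewrite -opprB charfunN cmod_conj.
(* Boundedness is needed for [sup] to dominate the elements of [S]; the sum of all the moduli, one
   per index, is a convenient bound. *)
have ubS : has_ubound S.
  exists (\sum_j cmod (charfun X (e j - E))) => x.
  move=> [l [/(eigenvalue_spectral _ UU UU' HE)[j ->] _] ->].
  by rewrite (bigD1 j) //= lerDl sumr_ge0 // => k _; exact: sqrtr_ge0.
have leS j : j != j0 -> cmod (charfun X (e j - E)) <= sup S.
  move=> jj0; apply: ub_le_sup => //; exists (e j) => //; split; last exact: nej0.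
  by apply/(eigenvalue_spectral _ UU UU' HE); exists j.
apply: (trnorm_dephasing_le UU UU' projE RTE) st_rho.
- by rewrite subrr charfun0.
- by move=> j k; rewrite -charfunN opprB.
(* If [E] is the only eigenvalue, [S] is empty and [sup] takes its default value 0, still an
   admissible [eps]. *)
- have [->|/set0P[x Sx]] := eqVneq S set0; first by rewrite sup0.
  by apply: le_trans (ub_le_sup ubS Sx); case: Sx => l _ ->; exact: sqrtr_ge0.
(* The multiplier has [E - e j] in column [j0] while [S] is indexed by [e j - E]; the moduli
   agree. *)
- by move=> j jj0; rewrite cmod_charfun ej0 leS.
Qed.
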